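(* Let $\beta\in\{1,2,4\}$, let $Q\in G_{\beta,n}$ be invertible and let $Z$ be the set of matrices in $G_{\beta,n}$ with determinant zero. Then $$d_{G_{\beta,n}}(Q,Z)=\sigma(Q).$$
   Context: For $\beta=1,2,4$, $G_{\beta,n}$ denotes the real vector space of $n\times n$ real symmetric, complex Hermitian, respectively quaternionic Hermitian matrices, with the Frobenius norm $\|Q\|^2=\sum_{i,j}|q_{ij}|^2$. Each $Q\in G_{\beta,n}$ has $n$ real eigenvalues $\lambda_1,\dots,\lambda_n$, and $\det(Q)=\lambda_1\cdots\lambda_n$ (this is the meaning of the determinant also for $\beta=4$). The least singular value is $\sigma(Q)=\min_j|\lambda_j|$, which equals $\|Q^{-1}\|_{\mathrm{op}}^{-1}$ for invertible $Q$. The distance is $d_{G_{\beta,n}}(Q,Z)=\inf_{X\in Z}\|Q-X\|$, with $X$ ranging over matrices in $G_{\beta,n}$ of determinant zero. *)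

(* Defs.v *)
From HB Require Import structures.
From mathcomp Require Import all_boot all_order all_algebra.
From mathcomp Require Import boolp classical_sets reals.
From mathcomp Require Import complex ring.

Set Implicit Arguments.
Unset Strict Implicit.
Unset Printing Implicit Defensive.

Import Order.TTheory GRing.Theory Num.Theory.

Local Open Scope classical_set_scope.
Local Open Scope ring_scope.

(* Quat a b c d is a + b i + c j + d k, with i^2 = j^2 = k^2 = ijk = -1. *)
Record quat (R : Type) : Type := Quat { qre : R; qi : R; qj : R; qk : R }.

Section Quaternion.
Variable R : comNzRingType.
Implicit Types x y z : quat R.

Definition quat_to_tuple x := (qre x, qi x, qj x, qk x).
Definition quat_of_tuple (t : R * R * R * R) :=
  let: (a, b, c, d) := t in Quat a b c d.
Lemma quat_to_tupleK : cancel quat_to_tuple quat_of_tuple.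
Proof. by case. Qed.

HB.instance Definition _ := Choice.copy (quat R) (can_type quat_to_tupleK).

Definition quat0 : quat R := Quat 0 0 0 0.
Definition quat1 : quat R := Quat 1 0 0 0.
Definition quat_opp x : quat R := Quat (- qre x) (- qi x) (- qj x) (- qk x).
Definition quat_add x y : quat R :=
  Quat (qre x + qre y) (qi x + qi y) (qj x + qj y) (qk x + qk y).
Definition quat_mul x y : quat R :=
  let: Quat a1 b1 c1 d1 := x in
  let: Quat a2 b2 c2 d2 := y in
  Quat (a1 * a2 - b1 * b2 - c1 * c2 - d1 * d2)
       (a1 * b2 + b1 * a2 + c1 * d2 - d1 * c2)
       (a1 * c2 - b1 * d2 + c1 * a2 + d1 * b2)
       (a1 * d2 + b1 * c2 - c1 * b2 + d1 * a2).

Lemma quat_addA : associative quat_add.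
Proof. by case=> ????[????][????]; congr Quat; apply: addrA. Qed.
Lemma quat_addC : commutative quat_add.
Proof. by case=> ????[????]; congr Quat; apply: addrC. Qed.
Lemma quat_add0 : left_id quat0 quat_add.
Proof. by case=> ????; congr Quat; apply: add0r. Qed.
Lemma quat_addN : left_inverse quat0 quat_opp quat_add.
Proof. by case=> ????; congr Quat; apply: addNr. Qed.

HB.instance Definition _ :=
  GRing.isZmodule.Build (quat R) quat_addA quat_addC quat_add0 quat_addN.

Lemma quat_mulA : associative quat_mul.
Proof. by case=> ????[????][????]; congr Quat; ring. Qed.
Lemma quat_mul1l : left_id quat1 quat_mul.
Proof. by case=> ????; congr Quat; ring. Qed.
Lemma quat_mul1r : right_id quat1 quat_mul.
Proof. by case=> ????; congr Quat; ring. Qed.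
Lemma quat_mulDl : left_distributive quat_mul quat_add.
Proof. by case=> ????[????][????]; congr Quat => /=; ring. Qed.
Lemma quat_mulDr : right_distributive quat_mul quat_add.
Proof. by case=> ????[????][????]; congr Quat => /=; ring. Qed.
Lemma quat_1neq0 : quat1 != 0.
Proof. by apply/eqP => -[] /eqP; rewrite oner_eq0. Qed.

HB.instance Definition _ := GRing.Zmodule_isNzRing.Build (quat R)
  quat_mulA quat_mul1l quat_mul1r quat_mulDl quat_mulDr quat_1neq0.

Definition quat_conj x : quat R := Quat (qre x) (- qi x) (- qj x) (- qk x).

End Quaternion.

Definition quat_abs (R : rcfType) (x : quat R) : R :=
  Num.sqrt (qre x ^+ 2 + qi x ^+ 2 + qj x ^+ 2 + qk x ^+ 2).

(* The values 1, 2, 4 of the index beta. *)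
Inductive dyson := Beta1 | Beta2 | Beta4.

Definition scalars (R : realType) (beta : dyson) : nzRingType :=
  match beta with Beta1 => R | Beta2 => R[i] | Beta4 => quat R end.

Definition conj_scalar (R : realType) (beta : dyson) :
    scalars R beta -> scalars R beta :=
  match beta return scalars R beta -> scalars R beta with
  | Beta1 => fun x => x
  | Beta2 => @conjc R
  | Beta4 => @quat_conj R
  end.

Definition abs_scalar (R : realType) (beta : dyson) : scalars R beta -> R :=
  match beta return scalars R beta -> R with
  | Beta1 => fun x : R => `|x|
  | Beta2 => @ComplexField.Normc.normc R
  | Beta4 => @quat_abs R
  end.

Definition real_scalar (R : realType) (beta : dyson) : R -> scalars R beta :=
  match beta return R -> scalars R beta with
  | Beta1 => fun x => x
  | Beta2 => fun x => Complex x 0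
  | Beta4 => fun x => Quat x 0 0 0
  end.

Section HermitianMatrices.
Variables (R : realType) (beta : dyson) (n : nat).
Local Notation scalars := (scalars R beta).
Implicit Types (Q X P : 'M[scalars]_n) (l : 'rV[R]_n).

(* On R the conjugation is the identity, so selfadjoint means symmetric. *)
Definition selfadjoint Q : Prop := map_mx (@conj_scalar R beta) Q^T = Q.

Definition frobenius Q : R := Num.sqrt (\sum_i \sum_j abs_scalar (Q i j) ^+ 2).

Definition inverse_of Q P : Prop := Q *m P = 1%:M /\ P *m Q = 1%:M.

Definition invertible Q : Prop := exists P, inverse_of Q P.

(* l lists the eigenvalues of Q with multiplicity: the columns of P form a
   basis of the right vector space of column vectors, and the j-th column v_j
   satisfies Q v_j = v_j l_j. *)
Definition is_spectrum Q l : Prop :=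
  exists2 P, invertible P &
    Q *m P = P *m diag_mx (map_mx (@real_scalar R beta) l).

(* By the spectral theorem is_spectrum Q l holds for some l when Q is
   selfadjoint, and l is then unique up to order; the default value 0 of xget
   is irrelevant. *)
Definition eigenvalues Q : 'rV[R]_n := xget 0 [set l | is_spectrum Q l].

Definition hdet Q : R := \prod_j eigenvalues Q 0 j.

Definition singular_selfadjoint : set 'M[scalars]_n :=
  [set X | selfadjoint X /\ hdet X = 0].

Definition frobenius_dist Q (Z : set 'M[scalars]_n) : R :=
  inf [set frobenius (Q - X) | X in Z].

End HermitianMatrices.

(* The seed of the iterated minimum is one of its terms, so this is the
   minimum over all j. *)
Definition least_singular_value (R : realType) (beta : dyson) (n : nat)
    (Q : 'M[scalars R beta]_n.+1) : R :=
  \big[Num.min/`|eigenvalues Q 0 ord0|]_j `|eigenvalues Q 0 j|.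

(* For beta = 1, 2 the product of the eigenvalues is the usual determinant. *)
Section CommutativeDeterminant.
Variables (R : realType) (n : nat).

Let det_similar (K : comUnitRingType) (Q P P' D : 'M[K]_n) :
  P *m P' = 1%:M -> Q *m P = P *m D -> \det Q = \det D.
Proof.
move=> PP' QP; have dP : \det P * \det P' = 1 by rewrite -det_mulmx PP' det1.
have /(congr1 (fun x => x * \det P')) : \det Q * \det P = \det P * \det D.
  by rewrite -!det_mulmx QP.
by rewrite -mulrA dP mulr1 => ->; rewrite mulrAC dP mul1r.
Qed.

Lemma det_spectrum_real (Q : 'M[R]_n) (l : 'rV[R]_n) :
  @is_spectrum R Beta1 n Q l -> \det Q = \prod_j l 0 j.
Proof.
case=> P [P' [PP' _]] /(det_similar PP') ->.
by rewrite det_diag; apply: eq_bigr => j _; rewrite mxE.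
Qed.

Lemma det_spectrum_complex (Q : 'M[R[i]]_n) (l : 'rV[R]_n) :
  @is_spectrum R Beta2 n Q l -> \det Q = ((\prod_j l 0 j)%:C)%C.
Proof.
case=> P [P' [PP' _]] /(det_similar PP') ->.
by rewrite det_diag rmorph_prod; apply: eq_bigr => j _; rewrite mxE.
Qed.

End CommutativeDeterminant.

(* Main.v *)
(* Let m = sigma(Q).  If Q u = u a with |u| = 1 and |a| = m, then Q - a u u^*
   is selfadjoint, kills u, and lies at distance m from Q.  Conversely, if X is
   selfadjoint of determinant zero, then X u = 0 for some unit vector u, and
   ||Q - X|| >= |(Q - X) u| = |Q u| >= m by diagonalizing Q orthonormally.

   The spectral theorem is proved simultaneously over R, C and H.  On the
   orthogonal of the eigenvectors already found, a vector v is annihilated by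
   p(Q) for some nonzero real polynomial p, because the real dimension is
   finite; a quadratic factor (X - a)^2 + b^2 of p with b <> 0 is injective at
   Q, hence the factorization of p over C yields a real eigenvalue. *)
From HB Require Import structures.
Require Import Defs.
From mathcomp Require Import all_boot all_order all_algebra.
From mathcomp Require Import boolp classical_sets reals.
From mathcomp Require Import complex ring lra.

Set Implicit Arguments.
Unset Strict Implicit.
Unset Printing Implicit Defensive.

Import Order.TTheory GRing.Theory Num.Theory.

Local Open Scope ring_scope.

(** * Conjugation, modulus and the real subfield, uniformly over R, C and H *)

Section Scalars.
Variables (R : realType) (beta : dyson).
Local Notation K := (scalars R beta).
Local Notation cj := (@conj_scalar R beta).
Local Notation rs := (@real_scalar R beta).
Implicit Types (x y : K) (a b : R).

Lemma conj_scalarD x y : cj (x + y) = cj x + cj y.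
Proof.
case: beta x y => //= [[a b] [c d]|[a b c d] [a' b' c' d']] /=.
  by congr Complex => /=; ring.
by congr Quat; rewrite /= ?opprD.
Qed.

Lemma conj_scalarM x y : cj (x * y) = cj y * cj x.
Proof.
case: beta x y => /= [x y|[a b] [c d]|[a b c d] [a' b' c' d']] /=.
- exact: mulrC.
- by congr Complex => /=; ring.
- by congr Quat => /=; ring.
Qed.

Lemma conj_scalarK : involutive cj.
Proof.
case: beta => //= [[a b]|[a b c d]] /=; first by rewrite opprK.
by congr Quat; rewrite /= ?opprK.
Qed.

Lemma conj_real_scalar a : cj (rs a) = rs a.
Proof. by case: beta => //=; rewrite /quat_conj /= ?oppr0. Qed.

Lemma real_scalarD a b : rs (a + b) = rs a + rs b.
Proof.
case: beta => //=; first by rewrite -[RHS](rmorphD (real_complex R)).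
by congr Quat => /=; rewrite addr0.
Qed.

Lemma real_scalarM a b : rs (a * b) = rs a * rs b.
Proof.
case: beta => //=; first by rewrite -[RHS](rmorphM (real_complex R)).
by congr Quat => /=; ring.
Qed.

Lemma real_scalar1 : rs 1 = 1.
Proof. by case: beta. Qed.

Lemma real_scalar_is_zmod_morphism : zmod_morphism rs.
Proof.
by move=> a b; apply: (addIr (rs b)); rewrite -real_scalarD !subrK.
Qed.
HB.instance Definition _ := GRing.isZmodMorphism.Build R K rs
  real_scalar_is_zmod_morphism.
HB.instance Definition _ := GRing.isMonoidMorphism.Build R K rs
  (real_scalar1, real_scalarM).

Lemma conj_scalar_is_zmod_morphism : zmod_morphism cj.
Proof.
by move=> x y; apply: (addIr (cj y)); rewrite -conj_scalarD !subrK.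
Qed.
HB.instance Definition _ := GRing.isZmodMorphism.Build K K cj
  conj_scalar_is_zmod_morphism.

(** Centrality of the reals, also inside H: it lets left scaling by a real number pass through
    matrix products and stand for the right scaling in an eigenvector equation. *)
Lemma real_scalar_comm a x : rs a * x = x * rs a.
Proof.
case: beta x => /= [x|x|[? ? ? ?]]; try exact: mulrC.
by congr Quat => /=; ring.
Qed.

Lemma real_scalar_inj : injective rs.
Proof. by case: beta => //= a b []. Qed.

Lemma mulr_conj_scalar x : x * cj x = rs (abs_scalar x ^+ 2).
Proof.
case: beta x => /= [x|[a b]|[a b c d]].
- by rewrite -normrX ger0_norm ?sqr_ge0.
- rewrite sqr_sqrtr ?addr_ge0 ?sqr_ge0 //.
  by congr Complex => /=; ring.
- rewrite /quat_abs sqr_sqrtr ?addr_ge0 ?sqr_ge0 //.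
  by congr Quat => /=; ring.
Qed.

Lemma abs_scalar_conj x : abs_scalar (cj x) = abs_scalar x.
Proof.
case: beta x => //= [[a b]|[a b c d]] /=; first by rewrite sqrrN.
by rewrite /quat_abs /= !sqrrN.
Qed.

Lemma abs_scalar_eq0 x : abs_scalar x = 0 -> x = 0.
Proof.
case: beta x => /= [x /eqP|x|[a b c d]].
- by rewrite normr_eq0 => /eqP.
- exact: ComplexField.Normc.eq0_normc.
- move/eqP; rewrite sqrtr_eq0 /= => h.
  have := sqr_ge0 a; have := sqr_ge0 b; have := sqr_ge0 c.
  have := sqr_ge0 d => *.
  suff [-> -> -> ->] : [/\ a = 0, b = 0, c = 0 & d = 0] by [].
  by split; apply/eqP; rewrite -sqrf_eq0; apply/eqP; lra.
Qed.

Definition scalar_dim :=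
  match beta with Beta1 => 1 | Beta2 => 2 | Beta4 => 4 end%N.

End Scalars.

(** * Real coordinates of scalars and column vectors *)

Definition scalar_of_row (R : realType) (beta : dyson) :
    'rV[R]_(scalar_dim beta) -> scalars R beta :=
  match beta return 'rV[R]_(scalar_dim beta) -> scalars R beta with
  | Beta1 => fun r : 'rV_1 => r 0 0
  | Beta2 => fun r : 'rV_2 => Complex (r 0 0) (r 0 1)
  | Beta4 => fun r : 'rV_4 =>
      Quat (r 0 0) (r 0 1) (r 0 (inord 2)) (r 0 (inord 3))
  end.

Definition row_of_scalar (R : realType) (beta : dyson) :
    scalars R beta -> 'rV[R]_(scalar_dim beta) :=
  match beta return scalars R beta -> 'rV[R]_(scalar_dim beta) with
  | Beta1 => fun x => \row__ x
  | Beta2 => fun x : R[i] => \row_j [:: complex.Re x; complex.Im x]`_j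
  | Beta4 => fun x : quat R => \row_j [:: qre x; qi x; qj x; qk x]`_j
  end.

Section Coordinates.
Variables (R : realType) (beta : dyson).
Local Notation K := (scalars R beta).
Local Notation rs := (@real_scalar R beta).

Lemma row_of_scalarK : cancel (@row_of_scalar R beta) (@scalar_of_row R beta).
Proof.
case: beta => /= [x|[a b]|[a b c d]] /=; rewrite !mxE //=.
by rewrite !inordK.
Qed.

Lemma scalar_of_rowK : cancel (@scalar_of_row R beta) (@row_of_scalar R beta).
Proof.
case: beta => /= r; apply/rowP => j; rewrite !mxE /=.
- by rewrite ord1.
- by case: j => [[|[|//]]] p /=; congr (r _ _); apply: val_inj.
- by case: j => [[|[|[|[|//]]]]] p /=; congr (r _ _); apply: val_inj;
    rewrite //= inordK.
Qed.

Lemma scalar_of_row_linear a (u v : 'rV[R]_(scalar_dim beta)) :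
  scalar_of_row (a *: u + v) = rs a * scalar_of_row u + scalar_of_row v.
Proof.
case: beta u v => /= u v; rewrite !mxE //.
  by congr Complex => /=; ring.
by congr Quat => /=; ring.
Qed.

(** Identifies K^n with a real coordinate space, so that dimension counts are made over the field R
    even when K is the noncommutative ring H. *)
Definition vec_of_row n (r : 'rV[R]_(n * scalar_dim beta)) : 'cV[K]_n :=
  \col_i scalar_of_row (row i (vec_mx r)).

Definition row_of_vec n (v : 'cV[K]_n) : 'rV[R]_(n * scalar_dim beta) :=
  mxvec (\matrix_i row_of_scalar (v i 0)).

Lemma row_of_vecK n : cancel (@row_of_vec n) (@vec_of_row n).
Proof.
by move=> v; apply/colP => i; rewrite mxE mxvecK rowK row_of_scalarK.
Qed.

Lemma vec_of_rowK n : cancel (@vec_of_row n) (@row_of_vec n).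
Proof.
move=> r; rewrite -[RHS]vec_mxK; congr mxvec; apply/row_matrixP => i.
by rewrite rowK mxE scalar_of_rowK.
Qed.

Lemma vec_of_row_linear n a (u v : 'rV[R]_(n * scalar_dim beta)) :
  vec_of_row (a *: u + v) = rs a *: vec_of_row u + vec_of_row v.
Proof. by apply/colP => i; rewrite !mxE !linearP scalar_of_row_linear. Qed.

Lemma row_of_vec_linear n a (u v : 'cV[K]_n) :
  row_of_vec (rs a *: u + v) = a *: row_of_vec u + row_of_vec v.
Proof.
by rewrite -{1}[u]row_of_vecK -{1}[v]row_of_vecK -vec_of_row_linear vec_of_rowK.
Qed.

Lemma vec_of_row0 n : vec_of_row (0 : 'rV[R]_(n * scalar_dim beta)) = 0.
Proof.
have := vec_of_row_linear (-1) 0 (0 : 'rV[R]_(n * scalar_dim beta)).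
by rewrite scaler0 addr0 rmorphN1 scaleN1r addNr.
Qed.

Lemma row_of_vec0 n : row_of_vec (0 : 'cV[K]_n) = 0.
Proof. by rewrite -vec_of_row0 vec_of_rowK. Qed.

End Coordinates.

(** Rank-nullity; every dimension count below reduces to this one with F = R. *)
Lemma linear_nontrivial_kernel (F : fieldType) N M (f : 'rV[F]_N -> 'rV[F]_M) :
  linear f -> (M < N)%N -> exists2 x, x != 0 & f x = 0.
Proof.
move=> lf MN.
pose g : {linear 'rV[F]_N -> 'rV[F]_M} :=
  HB.pack f (GRing.isLinear.Build F 'rV[F]_N 'rV[F]_M *:%R f lf).
have : kermx (lin1_mx g) != 0.
  rewrite -mxrank_eq0 mxrank_ker subn_eq0 -ltnNge.
  exact: leq_ltn_trans (rank_leq_col _) MN.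
case/rowV0Pn => x /sub_kermxP xf x0; exists x => //.
by rewrite -[LHS](mul_rV_lin1 g).
Qed.

(** * Adjoints, the squared Frobenius norm, and kernels of matrices over K *)

Section Adjoint.
Variables (R : realType) (beta : dyson).
Local Notation K := (scalars R beta).
Local Notation cj := (@conj_scalar R beta).
Local Notation rs := (@real_scalar R beta).

(** Rectangular, so as to cover vectors and partial orthonormal families; for square matrices
    [selfadjoint Q] unfolds to [adjoint Q = Q]. *)
Definition adjoint m n (A : 'M[K]_(m, n)) : 'M[K]_(n, m) := map_mx cj A^T.

Lemma adjointM m n p (A : 'M[K]_(m, n)) (B : 'M[K]_(n, p)) :
  adjoint (A *m B) = adjoint B *m adjoint A.
Proof.
apply/matrixP => i j; rewrite !mxE raddf_sum; apply: eq_bigr => k _.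
by rewrite !mxE /= conj_scalarM.
Qed.

Lemma adjointK m n (A : 'M[K]_(m, n)) : adjoint (adjoint A) = A.
Proof. by apply/matrixP => i j; rewrite !mxE conj_scalarK. Qed.

Lemma adjointB m n (A B : 'M[K]_(m, n)) :
  adjoint (A - B) = adjoint A - adjoint B.
Proof. by apply/matrixP => i j; rewrite !mxE raddfB. Qed.

Lemma adjointD m n (A B : 'M[K]_(m, n)) :
  adjoint (A + B) = adjoint A + adjoint B.
Proof. by apply/matrixP => i j; rewrite !mxE raddfD. Qed.

Lemma adjoint0 m n : adjoint (0 : 'M[K]_(m, n)) = 0.
Proof. by apply/matrixP => i j; rewrite !mxE raddf0. Qed.

Lemma adjointZ m n a (A : 'M[K]_(m, n)) :
  adjoint (rs a *: A) = rs a *: adjoint A.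
Proof.
apply/matrixP => i j.
by rewrite !mxE /= conj_scalarM conj_real_scalar real_scalar_comm.
Qed.

Lemma adjoint1 n : adjoint (1%:M : 'M[K]_n) = 1%:M.
Proof.
apply/matrixP => i j; rewrite !mxE eq_sym; case: eqP => _; last exact: raddf0.
by rewrite -(rmorph1 rs) conj_real_scalar.
Qed.

Lemma adjoint_row_mx m n1 n2 (A : 'M[K]_(m, n1)) (B : 'M[K]_(m, n2)) :
  adjoint (row_mx A B) = col_mx (adjoint A) (adjoint B).
Proof. by rewrite /adjoint tr_row_mx map_col_mx. Qed.

Lemma mulmx_real_scale m n p a (A : 'M[K]_(m, n)) (B : 'M[K]_(n, p)) :
  A *m (rs a *: B) = rs a *: (A *m B).
Proof.
apply/matrixP => i j; rewrite !mxE mulr_sumr; apply: eq_bigr => k _.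
by rewrite !mxE !mulrA real_scalar_comm.
Qed.

Lemma real_scale_eq0 m n a (A : 'M[K]_(m, n)) :
  a != 0 -> rs a *: A = 0 -> A = 0.
Proof.
move=> a0 /(congr1 (fun B => rs a^-1 *: B)).
by rewrite scalerA -rmorphM /= mulVf // rmorph1 scale1r scaler0.
Qed.

(** The squared Frobenius norm, which on a column is the squared Euclidean norm. *)
Definition fsq m n (A : 'M[K]_(m, n)) : R :=
  \sum_i \sum_j abs_scalar (A i j) ^+ 2.

Lemma fsq_ge0 m n (A : 'M[K]_(m, n)) : 0 <= fsq A.
Proof. by do 2!apply: sumr_ge0 => ? _; exact: sqr_ge0. Qed.

(** The diagonal entries of A A^* are sums of terms x * conj x, hence real. As [real_scalar] is
    injective, norm identities can be checked on traces; over H the trace is not cyclic, so the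
    order of the factors matters. *)
Lemma mxtrace_mul_adjoint m n (A : 'M[K]_(m, n)) :
  \tr (A *m adjoint A) = rs (fsq A).
Proof.
rewrite /fsq rmorph_sum; apply: eq_bigr => i _; rewrite mxE rmorph_sum.
by apply: eq_bigr => j _; rewrite !mxE mulr_conj_scalar.
Qed.

Lemma fsq_adjoint m n (A : 'M[K]_(m, n)) : fsq (adjoint A) = fsq A.
Proof.
rewrite /fsq exchange_big; apply: eq_bigr => i _; apply: eq_bigr => j _.
by rewrite !mxE abs_scalar_conj.
Qed.

Lemma fsq_eq0 m n (A : 'M[K]_(m, n)) : fsq A = 0 -> A = 0.
Proof.
move=> A0; apply/matrixP => i j; rewrite mxE; apply: abs_scalar_eq0.
apply/eqP; rewrite -sqrf_eq0; apply/eqP.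
move: A0 => /psumr_eq0P A0.
have /psumr_eq0P A0i := A0 (fun i _ => sumr_ge0 _ (fun j _ => sqr_ge0 _)) i isT.
by apply: A0i => // k _; exact: sqr_ge0.
Qed.

Lemma adjoint_mul_col n (v : 'cV[K]_n) : adjoint v *m v = (rs (fsq v))%:M.
Proof.
rewrite [LHS]mx11_scalar -[in RHS]fsq_adjoint.
rewrite -(mxtrace_mul_adjoint (adjoint v)) adjointK.
by rewrite [\tr _]big_ord1.
Qed.

Lemma fsq_real_scale m n a (A : 'M[K]_(m, n)) :
  fsq (rs a *: A) = a ^+ 2 * fsq A.
Proof.
apply: (@real_scalar_inj R beta).
rewrite -(mxtrace_mul_adjoint (rs a *: A)) adjointZ.
rewrite -scalemxAl mulmx_real_scale scalerA mxtraceZ mxtrace_mul_adjoint.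
by rewrite -!rmorphM.
Qed.

Lemma fsq_isometry m n (U : 'M[K]_(m, n)) (v : 'cV[K]_n) :
  adjoint U *m U = 1%:M -> fsq (U *m v) = fsq v.
Proof.
move=> UU; have := adjoint_mul_col (U *m v).
rewrite adjointM -mulmxA (mulmxA (adjoint U)) UU mul1mx adjoint_mul_col.
by move/(congr1 (fun A : 'M_1 => A 0 0)); rewrite !mxE => /real_scalar_inj.
Qed.

(* Pythagoras: with B = A (1 - u u^* ), A A^* = (A u)(A u)^* + B B^*. *)
Lemma fsq_ge_mulmx m n (A : 'M[K]_(m, n)) (u : 'cV[K]_n) :
  fsq u = 1 -> fsq (A *m u) <= fsq A.
Proof.
move=> u1; pose B := A - A *m u *m adjoint u.
have uu : adjoint u *m u = 1%:M by rewrite adjoint_mul_col u1 rmorph1.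
have Bu : B *m u = 0.
  by rewrite mulmxBl -[_ *m adjoint u *m u]mulmxA uu mulmx1 subrr.
have Bu' : adjoint u *m adjoint B = 0 by rewrite -adjointM Bu adjoint0.
suff -> : fsq A = fsq (A *m u) + fsq B by rewrite lerDl fsq_ge0.
apply: (@real_scalar_inj R beta); rewrite rmorphD /= -(mxtrace_mul_adjoint A).
rewrite -(mxtrace_mul_adjoint B) -(mxtrace_mul_adjoint (A *m u)) -raddfD /=.
congr (\tr _); rewrite -{1 2}(subrK (A *m u *m adjoint u) A) -/B.
have -> : adjoint (B + A *m u *m adjoint u) = adjoint B + u *m adjoint (A *m u).
  by rewrite adjointD [adjoint (_ *m adjoint u)]adjointM adjointK.
rewrite mulmxDl !mulmxDr [B *m (u *m _)]mulmxA Bu mul0mx addr0.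
rewrite -[_ *m adjoint u *m adjoint B]mulmxA Bu' mulmx0 add0r addrC.
by rewrite -[_ *m adjoint u *m _]mulmxA [adjoint u *m _]mulmxA uu mul1mx.
Qed.

Lemma exists_unit_col n (v : 'cV[K]_n) :
  v != 0 -> exists2 a, a != 0 & fsq (rs a *: v) = 1.
Proof.
move=> v0; have f0 : fsq v != 0 by apply: contra v0 => /eqP /fsq_eq0 ->.
exists (Num.sqrt (fsq v))^-1.
  by rewrite invr_eq0 sqrtr_eq0 -ltNge lt_def f0 fsq_ge0.
by rewrite fsq_real_scale exprVn sqr_sqrtr ?fsq_ge0 // mulVf.
Qed.

(** Left multiplication by A is R-linear, and the real dimension drops from n d to m d with d =
    [scalar_dim beta]. *)
Lemma exists_kernel_col m n (A : 'M[K]_(m, n)) :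
  (m < n)%N -> exists2 v : 'cV[K]_n, v != 0 & A *m v = 0.
Proof.
move=> mn; have [||x x0 fx] := @linear_nontrivial_kernel R _ _
  (fun r : 'rV_(n * scalar_dim beta) => row_of_vec (A *m vec_of_row r)).
- move=> a u w; rewrite vec_of_row_linear mulmxDr mulmx_real_scale.
  exact: row_of_vec_linear.
- by rewrite ltn_pmul2r //; case: beta.
exists (vec_of_row x).
  apply: contra x0 => /eqP x0.
  by rewrite -[x]vec_of_rowK x0 row_of_vec0.
by rewrite -[LHS]row_of_vecK fx vec_of_row0.
Qed.

(** The columns of U U^* - 1 lie in the kernel of U^*, so this kernel has to be zero. If it
    contained v <> 0, the n x (n+1) matrix [U v] would kill some nonzero column; applying U^* and
    then v^* shows that both blocks of that column vanish. *)
Lemma isometry_coisometry n (U : 'M[K]_n) :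
  adjoint U *m U = 1%:M -> U *m adjoint U = 1%:M.
Proof.
move=> UU; suff ker v : adjoint U *m v = 0 :> 'cV_n -> v = 0.
  apply/eqP; rewrite -subr_eq0; apply/eqP/matrixP => i j.
  have : col j (U *m adjoint U - 1%:M) = 0.
    apply: ker; rewrite colE mulmxA mulmxBr mulmxA UU mul1mx mulmx1 subrr.
    exact: mul0mx.
  by move/colP/(_ i); rewrite [LHS]mxE [RHS]mxE => ->; rewrite mxE.
move=> Uv; have [|w w0] := exists_kernel_col (row_mx U v).
  by rewrite addn1.
rewrite -[w]vsubmxK mul_row_col => e.
have u0 : usubmx w = 0.
  have := congr1 (mulmx (adjoint U)) e.
  by rewrite mulmxDr !mulmxA UU Uv mul0mx mul1mx addr0 mulmx0.
move: e; rewrite u0 mulmx0 add0r => e.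
apply/eqP; apply: contraNT w0 => v0.
have fv0 : fsq v != 0 by apply: contra v0 => /eqP /fsq_eq0 ->.
have := congr1 (mulmx (adjoint v)) e.
rewrite mulmxA adjoint_mul_col mul_scalar_mx mulmx0 => /(real_scale_eq0 fv0) d0.
by rewrite -[w]vsubmxK u0 d0 col_mx0.
Qed.

End Adjoint.

(** * Real polynomials in Q and existence of a real eigenvalue *)

Section Spectral.
Variables (R : realType) (beta : dyson) (n : nat).
Local Notation K := (scalars R beta).
Local Notation rs := (@real_scalar R beta).
Variable Q : 'M[K]_n.+1.

Let real_mx : R -> 'M[K]_n.+1 := scalar_mx \o rs.

Lemma real_mx_comm : commr_rmorph real_mx Q.
Proof.
move=> a; rewrite /GRing.comm /real_mx /= -scalemx1 -!mulmxE.
by rewrite mulmx_real_scale mulmx1 -scalemxAl mul1mx.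
Qed.

Definition peval : {poly R} -> 'M[K]_n.+1 := horner_morph real_mx_comm.
HB.instance Definition _ := GRing.RMorphism.on peval.

Lemma peval_mulX p : peval (p * 'X) = peval p *m Q.
Proof. by rewrite rmorphM /= [peval 'X]horner_morphX. Qed.

Lemma pevalC a : peval a%:P = (rs a)%:M.
Proof. exact: horner_morphC. Qed.

(** With N the real dimension of K^(n+1), the real polynomials of degree at most N form a space of
    dimension N + 1, so p -> p(Q) v has a nontrivial kernel. *)
Lemma peval_annihilates (v : 'cV[K]_n.+1) :
  exists2 p : {poly R}, p != 0 & peval p *m v = 0.
Proof.
have [||c c0 fc] := @linear_nontrivial_kernel R (n.+1 * scalar_dim beta).+1 _
  (fun c => row_of_vec (peval (rVpoly c) *m v)).
- move=> a c d; rewrite linearP /= -mul_polyC rmorphD rmorphM /= pevalC.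
  by rewrite mulmxDl -mulmxE mul_scalar_mx -scalemxAl row_of_vec_linear.
- exact: ltnSn.
exists (rVpoly c).
  by apply: contra c0 => /eqP e; rewrite -[c]rVpolyK e linear0.
by rewrite -[LHS]row_of_vecK fc vec_of_row0.
Qed.

(** The relation W Q = D W makes the kernel of W invariant under Q, hence under every real
    polynomial in Q. *)
Lemma peval_stable k (W : 'M[K]_(k, n.+1)) D p (v : 'cV[K]_n.+1) :
  W *m Q = D *m W -> W *m v = 0 -> W *m (peval p *m v) = 0.
Proof.
move=> WQ; elim/poly_ind: p v => [|p a IH] v Wv.
  by rewrite rmorph0 mul0mx mulmx0.
rewrite rmorphD /= peval_mulX pevalC mulmxDl mulmxDr -mulmxA.
rewrite IH ?add0r ?mul_scalar_mx ?mulmx_real_scale ?Wv ?scaler0 //.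
by rewrite mulmxA WQ -mulmxA Wv mulmx0.
Qed.

Hypothesis hQ : adjoint Q = Q.

(* If (Q - a)^2 w = - b^2 w, pairing with w gives |(Q - a) w|^2 = - b^2 |w|^2. *)
Lemma peval_quadratic_inj (a b : R) (w : 'cV[K]_n.+1) :
  b != 0 -> peval (('X - a%:P) ^+ 2 + (b ^+ 2)%:P) *m w = 0 -> w = 0.
Proof.
move=> b0; set T := peval ('X - a%:P).
have TE : T = Q - rs a *: 1%:M.
  by rewrite /T rmorphB /= [peval 'X]horner_morphX pevalC scalemx1.
have hT : adjoint T = T by rewrite TE adjointB hQ adjointZ adjoint1.
rewrite rmorphD rmorphXn /= -/T pevalC mulmxDl mul_scalar_mx expr2.
move/(congr1 (mulmx (adjoint w))).
rewrite mulmxDr mulmx_real_scale mulmx0 -mulmxE -{1}hT !mulmxA -adjointM.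
rewrite -mulmxA !adjoint_mul_col.
move/(congr1 (fun A : 'M_1 => A 0 0)); rewrite !mxE /= !mulr1n.
rewrite -rmorphM -rmorphD -(rmorph0 rs) => /real_scalar_inj /eqP.
rewrite paddr_eq0 ?fsq_ge0 ?(mulr_ge0 (sqr_ge0 _) (fsq_ge0 _)) // mulf_eq0.
by rewrite sqrf_eq0 (negPf b0) => /andP[_ /eqP /fsq_eq0].
Qed.

(** Strong induction on the size of a polynomial p with p(Q) v = 0, splitting off a real linear or
    quadratic factor of p. The vector v changes only within the kernel of W. *)
Lemma exists_stable_eigenvector k (W : 'M[K]_(k, n.+1)) D (v : 'cV[K]_n.+1) :
  W *m Q = D *m W -> v != 0 -> W *m v = 0 ->
  exists a, exists w : 'cV[K]_n.+1,
    [/\ w != 0, W *m w = 0 & Q *m w = rs a *: w].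
Proof.
move=> WQ; have [p] := peval_annihilates v.
have [m] := ubnP (size p); elim: m => // m IH in p v *.
rewrite ltnS => pm p0 pv v0 Wv.
have [p1|p1] := leqP (size p) 1.
  move: pv p0; rewrite (size1_polyC p1) pevalC mul_scalar_mx polyC_eq0 => pv c0.
  by rewrite (real_scale_eq0 c0 pv) eqxx in v0.
(* Either q(Q) v = 0 and the induction applies to the smaller q, or q(Q) v is a nonzero vector in
   the kernel of W that is killed by d(Q). *)
have reduce d q : p = d * q -> (1 < size d)%N ->
    (forall w : 'cV[K]_n.+1, w != 0 -> W *m w = 0 -> peval d *m w = 0 ->
     exists a, exists w : 'cV[K]_n.+1,
      [/\ w != 0, W *m w = 0 & Q *m w = rs a *: w]) ->
    exists a, exists w : 'cV[K]_n.+1,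
      [/\ w != 0, W *m w = 0 & Q *m w = rs a *: w].
  move=> pE d1 Hd; have q0 : q != 0.
    by apply: contra p0 => /eqP q0; rewrite pE q0 mulr0.
  have [qv|qv] := eqVneq (peval q *m v) 0.
    apply: (IH q v) => //; apply: leq_trans pm.
    rewrite pE size_mul // -?size_poly_gt0 ?(ltn_trans _ d1) //.
    by case: (size d) d1 => [|[|s]] // _; rewrite !addSn ltnS leq_addl.
  apply: (Hd _ qv); first exact: peval_stable WQ Wv.
  by rewrite mulmxA mulmxE -rmorphM /= -pE.
pose toC := real_complex R.
(* A complex root a + b i of p: it gives the factor X - a if b = 0, and (X - a)^2 + b^2
   otherwise. *)
have /closed_rootP[[a b] /rootP pz] : size (map_poly toC p) != 1%N.
  by rewrite size_map_poly neq_ltn p1 orbT.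
have [b0|b0] := eqVneq b 0.
  have : root p a.
    apply/rootP; apply: (fmorph_inj toC); rewrite rmorph0 -horner_map.
    by rewrite -pz b0.
  case/factor_theorem => q; rewrite mulrC => pE.
  apply: (reduce _ _ pE); first by rewrite size_XsubC.
  move=> w w0 Ww; rewrite rmorphB /= [peval 'X]horner_morphX pevalC mulmxBl.
  by rewrite mul_scalar_mx => /subr0_eq Qw; exists a, w.
pose d := ('X - a%:P) ^+ 2 + (b ^+ 2)%:P : {poly R}.
have sd : size d = 3%N.
  by rewrite size_polyDl size_exp_XsubC // (leq_ltn_trans (size_polyC_leq1 _)).
have d0 : d != 0 by rewrite -size_poly_gt0 sd.
have dz : (map_poly toC d).[Complex a b] = 0.
  rewrite !rmorphE /= !hornerE /= !map_polyC !hornerC map_polyX hornerX /=.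
  by apply/eqP; rewrite eq_complex /=; apply/andP; split; apply/eqP => /=; ring.
(* The remainder r1 X + r0 vanishes at a + b i; the imaginary part r1 b = 0 forces r1 = 0, and then
   the real part gives r0 = 0. *)
have pd : p %% d = 0.
  have rz : (map_poly toC (p %% d)).[Complex a b] = 0.
    move: pz; rewrite {1}(divp_eq p d) rmorphD rmorphM /= !hornerE dz mulr0.
    by rewrite add0r.
  have sr : leq (size (p %% d)) 2 by rewrite -ltnS -sd ltn_modp.
  have rE : p %% d = (p %% d)`_1 *: 'X + ((p %% d)`_0)%:P.
    apply/polyP => -[|[|i]]; rewrite !coefE /= ?mulr0 ?mulr1 ?add0r ?addr0 //.
    by rewrite nth_default // (leq_trans sr).
  move: rz; rewrite rE; set r1 := _`_1; set r0 := _`_0.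
  rewrite rmorphD /= map_polyZ map_polyX map_polyC /= !hornerE /=.
  move/eqP; rewrite eq_complex /= => /andP[/eqP h0 /eqP h1].
  have r10 : r1 = 0.
    by apply: (mulIf b0); rewrite mul0r -h1 /=; ring.
  have -> : r0 = 0 by rewrite -h0 r10 /=; ring.
  by rewrite r10 scale0r add0r.
apply: (reduce d (p %/ d)); last 1 first.
(* Vacuous case: d(Q) is injective, so it kills no nonzero w. *)
- move=> w w0 _ dw; case/eqP: w0; exact: (peval_quadratic_inj b0 dw).
- by rewrite {1}(divp_eq p d) pd addr0 mulrC.
- by rewrite sd.
Qed.

End Spectral.

(** * The spectral theorem, eigenvalues and the determinant *)

Section Spectrum.
Variables (R : realType) (beta : dyson).
Local Notation K := (scalars R beta).
Local Notation rs := (@real_scalar R beta).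
Local Notation rdiag l := (diag_mx (map_mx rs l)).

Lemma adjoint_rdiag n (l : 'rV[R]_n) : adjoint (rdiag l) = rdiag l.
Proof.
apply/matrixP => i j; rewrite !mxE eq_sym.
by case: eqP => [->|_]; rewrite ?mulr1n ?conj_real_scalar // !mulr0n raddf0.
Qed.

Lemma rdiag_mulE n (l : 'rV[R]_n) (w : 'cV[K]_n) j :
  (rdiag l *m w) j 0 = rs (l 0 j) * w j 0.
Proof. by rewrite mul_diag_mx !mxE. Qed.

(** Induction on k: the orthogonal of the k columns of U is the kernel of U^*, nonzero while k < n +
    1 and stable under Q, so it contains a further unit eigenvector. *)
Lemma orthonormal_eigenvectors n (Q : 'M[K]_n.+1) k : adjoint Q = Q ->
  (k <= n.+1)%N -> exists U : 'M[K]_(n.+1, k), exists l : 'rV[R]_k,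
    adjoint U *m U = 1%:M /\ Q *m U = U *m rdiag l.
Proof.
move=> hQ; elim: k => [|k IH] kn.
  by exists 0, 0; split; rewrite ?mulmx0 ?mul0mx //; apply/matrixP => -[].
have [U [l [UU QU]]] := IH (ltnW kn).
have UQ : adjoint U *m Q = rdiag l *m adjoint U.
  by rewrite -{1}hQ -adjointM QU adjointM adjoint_rdiag.
have [v v0 Uv] := exists_kernel_col (adjoint U) kn.
have [a [w [w0 Uw Qw]]] := exists_stable_eigenvector hQ UQ v0 Uv.
have [c c0 u1] := exists_unit_col w0.
set u := rs c *: w in u1.
have Uu : adjoint U *m u = 0 by rewrite mulmx_real_scale Uw scaler0.
have Qu : Q *m u = rs a *: u.
  by rewrite mulmx_real_scale Qw !scalerA -!rmorphM mulrC.
rewrite -(addn1 k); exists (row_mx U u), (row_mx l a%:M); split.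
  rewrite adjoint_row_mx mul_col_row UU Uu adjoint_mul_col u1 real_scalar1.
  (* The remaining off-diagonal block u^* U is the adjoint of U^* u = 0. *)
  rewrite -[adjoint u *m U]adjointK adjointM adjointK Uu adjoint0.
  by rewrite [RHS]scalar_mx_block.
rewrite mul_mx_row QU Qu map_row_mx diag_mx_row mul_row_block !mulmx0 addr0.
rewrite add0r; congr row_mx; rewrite map_scalar_mx.
have -> : diag_mx (rs a)%:M = rs a *: 1%:M :> 'M[K]_1.
  by apply/matrixP => i j; rewrite !ord1 !mxE /= !mulr1n mulr1.
by rewrite mulmx_real_scale mulmx1.
Qed.

Lemma spectral_theorem n (Q : 'M[K]_n.+1) : adjoint Q = Q ->
  exists U : 'M[K]_n.+1, exists l : 'rV[R]_n.+1,
    [/\ adjoint U *m U = 1%:M, U *m adjoint U = 1%:M & Q *m U = U *m rdiag l].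
Proof.
move=> hQ; have [U [l [UU QU]]] := orthonormal_eigenvectors hQ (leqnn n.+1).
by exists U, l; split=> //; exact: isometry_coisometry.
Qed.

(** The spectral theorem provides a spectrum, so [xget] does not fall back on its default. *)
Lemma eigenvaluesP n (Q : 'M[K]_n.+1) : adjoint Q = Q ->
  is_spectrum Q (eigenvalues Q).
Proof.
move=> /spectral_theorem [U [l [UU UU' QU]]].
rewrite /eigenvalues; apply: (xgetPex 0); exists l, U => //.
by exists (adjoint U).
Qed.

(** In the eigenbasis P, the coordinates w = P^-1 v satisfy (l_j - a) w_j = 0 for all j; if no l_j
    equals a, then w = 0 and v = 0. *)
Lemma eigenvector_spectrum n (Q : 'M[K]_n) l (v : 'cV[K]_n) a :
  is_spectrum Q l -> v != 0 -> Q *m v = rs a *: v -> exists j, l 0 j = a.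
Proof.
case=> P [P' [PP' P'P]] QP v0 Qv; pose w := P' *m v.
have Dw : rdiag l *m w = rs a *: w.
  rewrite -[LHS]mul1mx -P'P -mulmxA [P *m (_ *m _)]mulmxA -QP -mulmxA /w.
  by rewrite [P *m (_ *m _)]mulmxA PP' mul1mx Qv mulmx_real_scale.
have [la|la] := pselect (exists j, l 0 j = a) => //.
case/eqP: v0; rewrite -[v]mul1mx -PP' -mulmxA -/w.
suff -> : w = 0 by rewrite mulmx0.
apply/colP => j; have lj : l 0 j - a != 0.
  by rewrite subr_eq0; apply/eqP => e; apply: la; exists j.
have : rs (l 0 j - a) *: row j w = 0.
  apply/rowP => i; rewrite ord1 mxE [row j w _ _]mxE [RHS]mxE rmorphB mulrBl.
  by rewrite -rdiag_mulE Dw mxE subrr.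
by move/(real_scale_eq0 lj)/rowP/(_ 0); rewrite !mxE.
Qed.

Lemma spectrum_eigenvector n (Q : 'M[K]_n) l j :
  is_spectrum Q l -> exists2 v : 'cV[K]_n, v != 0 & Q *m v = rs (l 0 j) *: v.
Proof.
case=> P [P' [PP' P'P]] QP; exists (P *m delta_mx j 0).
  apply/eqP => /(congr1 (mulmx P')); rewrite mulmxA P'P mul1mx mulmx0.
  by move/colP/(_ j); rewrite !mxE !eqxx => /eqP; rewrite oner_eq0.
rewrite mulmxA QP -mulmxA -mulmx_real_scale; congr (_ *m _).
apply/colP => i; rewrite rdiag_mulE !mxE.
by case: eqP => [->|_] //; rewrite !mulr0.
Qed.

Lemma hdet_eq0P n (X : 'M[K]_n.+1) : adjoint X = X ->
  hdet X = 0 <-> exists2 v : 'cV[K]_n.+1, v != 0 & X *m v = 0.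
Proof.
move=> hX; have sX := eigenvaluesP hX; split.
  move/eqP; rewrite /hdet prodf_seq_eq0 => /hasP[j _ /= /eqP lj].
  have [v v0 Xv] := spectrum_eigenvector j sX.
  by exists v => //; rewrite Xv lj rmorph0 scale0r.
case=> v v0 Xv; have [|j lj] := eigenvector_spectrum (a := 0) sX v0.
  by rewrite Xv rmorph0 scale0r.
by rewrite /hdet (bigD1 j) //= lj mul0r.
Qed.

(** * The least singular value and both bounds on the distance *)

Lemma least_singular_value_le n (Q : 'M[K]_n.+1) j :
  least_singular_value Q <= `|eigenvalues Q 0 j|.
Proof. exact: bigmin_le_cond. Qed.

Lemma least_singular_value_attained n (Q : 'M[K]_n.+1) :
  exists j, least_singular_value Q = `|eigenvalues Q 0 j|.
Proof.
rewrite /least_singular_value; elim/big_ind: _ => [|x y [i ->] [j ->]|j _].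
- by exists ord0.
- by rewrite minElt; case: ifP => _; [exists i | exists j].
- by exists j.
Qed.

Lemma least_singular_value_ge0 n (Q : 'M[K]_n.+1) : 0 <= least_singular_value Q.
Proof. by have [j ->] := least_singular_value_attained Q. Qed.

(** In orthonormal eigencoordinates w = U^* v, |Q v|^2 is the sum of l_i^2 |w_i|^2, and the bound
    holds term by term. *)
Lemma fsq_ge_least_singular_value n (Q : 'M[K]_n.+1) (v : 'cV[K]_n.+1) :
  adjoint Q = Q -> least_singular_value Q ^+ 2 * fsq v <= fsq (Q *m v).
Proof.
move=> hQ; have [U [l [UU UU' QU]]] := spectral_theorem hQ.
have sl : is_spectrum Q l by exists U => //; exists (adjoint U).
pose w := adjoint U *m v.
have vE : v = U *m w by rewrite mulmxA UU' mul1mx.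
rewrite vE mulmxA QU -mulmxA !(fsq_isometry _ UU) /fsq mulr_sumr.
apply: ler_sum => i _; rewrite !big_ord1.
(* The list l from the spectral theorem may differ from the chosen [eigenvalues Q], so each l_i is
   located in the latter through an eigenvector. *)
have [j0 j0E] : exists j, eigenvalues Q 0 j = l 0 i.
  have [u u0 Qu] := spectrum_eigenvector i sl.
  exact: eigenvector_spectrum (eigenvaluesP hQ) u0 Qu.
have -> : abs_scalar ((rdiag l *m w) i 0) ^+ 2 =
    l 0 i ^+ 2 * abs_scalar (w i 0) ^+ 2.
  have := fsq_real_scale (l 0 i) (row i w).
  by rewrite /fsq !big_ord1 rdiag_mulE !mxE.
apply: ler_wpM2r; first exact: sqr_ge0.
rewrite -(real_normK (num_real (l 0 i))) lerXn2r ?nnegrE //.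
  exact: least_singular_value_ge0.
by rewrite -j0E; exact: least_singular_value_le.
Qed.

Lemma frobenius_ge_least_singular_value n (Q X : 'M[K]_n.+1) :
  adjoint Q = Q -> singular_selfadjoint X ->
  least_singular_value Q <= frobenius (Q - X).
Proof.
move=> hQ [hX /(hdet_eq0P hX) [v v0 Xv]].
have [c c0 u1] := exists_unit_col v0.
rewrite -(ger0_norm (least_singular_value_ge0 Q)) -sqrtr_sqr ler_wsqrtr //.
rewrite -[X in X <= _]mulr1 -u1.
apply: le_trans (fsq_ge_least_singular_value _ hQ) _.
apply: le_trans (fsq_ge_mulmx (Q - X) u1).
by rewrite mulmxBl [X *m _]mulmx_real_scale Xv scaler0 subr0.
Qed.

Lemma frobenius_attains_least_singular_value n (Q : 'M[K]_n.+1) :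
  adjoint Q = Q -> exists2 X, singular_selfadjoint X &
    frobenius (Q - X) = least_singular_value Q.
Proof.
move=> hQ; have [j ->] := least_singular_value_attained Q.
have [v v0 Qv] := spectrum_eigenvector j (eigenvaluesP hQ).
set a := eigenvalues Q 0 j in Qv *.
have [c c0 u1] := exists_unit_col v0; set u := rs c *: v in u1.
have Qu : Q *m u = rs a *: u.
  by rewrite mulmx_real_scale Qv !scalerA -!rmorphM mulrC.
have uu : adjoint u *m u = 1%:M by rewrite adjoint_mul_col u1 rmorph1.
have u0 : u != 0.
  apply/eqP => u0; move: u1; rewrite u0 -(scale0r u) -(rmorph0 rs).
  by rewrite fsq_real_scale expr0n mul0r => /esym/eqP; rewrite oner_eq0.
pose E := rs a *: (u *m adjoint u).
have hX : adjoint (Q - E) = Q - E.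
  by rewrite adjointB hQ adjointZ adjointM adjointK.
exists (Q - E).
  split=> //; apply/(hdet_eq0P hX); exists u => //.
  by rewrite mulmxBl Qu -scalemxAl -mulmxA uu mulmx1 subrr.
rewrite subKr -sqrtr_sqr; congr Num.sqrt; rewrite -/(fsq E) fsq_real_scale.
suff -> : fsq (u *m adjoint u) = 1 by rewrite mulr1.
apply: (@real_scalar_inj R beta).
rewrite -(mxtrace_mul_adjoint (u *m adjoint u)) adjointM adjointK.
by rewrite mulmxA -[u *m _ *m u]mulmxA uu mulmx1 mxtrace_mul_adjoint u1.
Qed.

End Spectrum.

Theorem theorem1 (R : realType) (beta : dyson) (n : nat)
  (Q : 'M[scalars R beta]_n.+1)
  (hQ : selfadjoint Q) (invQ : invertible Q) :
  frobenius_dist Q (@singular_selfadjoint R beta n.+1) = least_singular_value Q.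
Proof.
have [X0 sX0 QX0] := frobenius_attains_least_singular_value hQ.
have lbQ : lbound
    [set frobenius (Q - X) | X in @singular_selfadjoint R beta n.+1]%classic
    (least_singular_value Q).
  by move=> _ [X sX <-]; exact: frobenius_ge_least_singular_value.
(* The infimum is attained at X0: the lower bound gives one inequality directly, and supplies the
   boundedness that [ge_inf] requires for the other. *)
apply/eqP; rewrite eq_le; apply/andP; split.
  rewrite -QX0; apply: ge_inf; first by exists (least_singular_value Q).
  by exists X0.
by apply: lb_le_inf => //; exists (frobenius (Q - X0)), X0.
Qed.
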